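(* Let $\mathbb{F}$ be any field, $k\ge3$, $t\in V_1\otimes\cdots\otimes V_k$ a tensor over $\mathbb{F}$ and $\theta\in\mathcal{P}([k])$. Then $\limsup_{n\to\infty}\mathrm{SR}(t^{\otimes n})^{1/n}\le\zeta^\theta(t)$.
   Context: $V_i$ are finite-dimensional $\mathbb{F}$-vector spaces of dimension $n_i$; $t^{\otimes n}$ is viewed as a $k$-tensor in $V_1^{\otimes n}\otimes\cdots\otimes V_k^{\otimes n}$. A slice in $U_1\otimes\cdots\otimes U_k$ is $v\otimes w$ with $v\in U_j$, $w\in\bigotimes_{i\ne j}U_i$ for some $j$; slice rank $\mathrm{SR}$ is the least number of slices summing to the tensor. Strassen upper support functional: for a $k$-tuple $C$ of bases of $V_1,\dots,V_k$ (indexed by $[n_i]$), $\operatorname{supp}_Ct$ is the set of index tuples $\alpha$ with nonzero coefficient of $v_{1,\alpha_1}\otimes\cdots\otimes v_{k,\alpha_k}$ in $t$; $\rho^\theta(t)=\min_C\max_{P\in\mathcal{P}(\operatorname{supp}_Ct)}\sum_i\theta(i)H(P_i)$ with $P_i$ the marginals and $H$ Shannon entropy base 2; $\zeta^\theta(t)=2^{\rho^\theta(t)}$, $\zeta^\theta(0)=0$. *)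

(* Defs.v *)
From HB Require Import structures.
From mathcomp Require Import all_boot all_order all_algebra.
From mathcomp Require Import all_classical all_reals all_analysis.

Set Implicit Arguments.
Unset Strict Implicit.
Unset Printing Implicit Defensive.

Import Order.TTheory GRing.Theory Num.Theory.

Local Open Scope ring_scope.

Section Tensors.
Variables (F : fieldType) (K : finType) (V : K -> vectType F).

Definition tidx := {dffun forall i : K, 'I_(\dim {: V i})}.

(* A model of the tensor product of the spaces V i: the coordinate arrays of
   tensors with respect to the products of the vectors of the library's chosen
   bases vbasis {: V i}.  [pure] is the universal multilinear map into it. *)
Definition tens := {ffun tidx -> F^o}.
HB.instance Definition _ := Vector.on tens.

Definition pure (v : forall i, V i) : tens :=
  [ffun a : tidx => \prod_i coord (vbasis {: V i}) (a i) (v i)].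

End Tensors.

Section SliceRank.
Variables (F : fieldType) (K : finType) (V : K -> vectType F).

Definition others (j : K) (i : {i : K | i != j}) : vectType F := V (val i).

Definition restr (j : K) (a : tidx V) : tidx (@others j) :=
  [ffun i : {i : K | i != j} => a (val i)].

(* v (x) w, with v put in position j *)
Definition slice (j : K) (v : V j) (w : tens (@others j)) : tens V :=
  [ffun a : tidx V => coord (vbasis {: V j}) (a j) v * w (restr j a)].

Definition is_slice (s : tens V) : Prop :=
  exists (j : K) (v : V j) (w : tens (@others j)), s = slice v w.

Definition slice_decomposable (t : tens V) (r : nat) : Prop :=
  exists s : 'I_r -> tens V, (forall l, is_slice (s l)) /\ t = \sum_l s l.

Definition slice_rank (t : tens V) : nat :=
  xget 0%N [set r | slice_decomposable t r /\
                    forall r', slice_decomposable t r' -> (r <= r')%N]%classic.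

Lemma slice_decomposable_ex (t : tens V) (j : K) :
  exists r, slice_decomposable t r.
Proof.
exists #|{: tidx V}|.
exists (fun l => let a : tidx V := enum_val l in
  slice (vbasis {: V j})`_(a j)
        [ffun b => t a *+ (b == restr j a)] : tens V).
split=> [l|]; first by do 3 eexists.
apply/ffunP=> b; rewrite sum_ffunE.
rewrite (bigD1 (enum_rank b)) //= enum_rankK !ffunE eqxx.
rewrite coord_free ?(basis_free (vbasisP _)) // eqxx mul1r big1 ?addr0 // => l.
rewrite !ffunE coord_free ?(basis_free (vbasisP _)) //.
set a : tidx V := enum_val l => nlb.
have nab : a != b.
  by apply: contraNneq nlb => <-; rewrite /a enum_valK.
case: eqP => [ejb|_]; last by rewrite mul0r.
case: eqP => [erb|_]; last by rewrite mulr0.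
case/eqP: nab; apply/ffunP => i; case: (eqVneq i j) => [->|nij].
  exact: ejb.
by have /ffunP/(_ (exist _ i nij)) := erb; rewrite !ffunE.
Qed.

Lemma slice_rankP (t : tens V) (j : K) :
  slice_decomposable t (slice_rank t) /\
  forall r, slice_decomposable t r -> (slice_rank t <= r)%N.
Proof.
have ex : exists r, `[< slice_decomposable t r >].
  by have [r tr] := slice_decomposable_ex t j; exists r; apply/asboolP.
rewrite /slice_rank; case: xgetP => [r -> []//|/(_ (ex_minn ex))[]].
case: ex_minnP => m /asboolP tm mP; split=> // r /asboolP; exact: mP.
Qed.

End SliceRank.

Section Power.
Variables (F : fieldType) (K : finType) (V : K -> vectType F).

Definition tens_pow_space (n : nat) (i : K) : vectType F :=
  tens (fun _ : 'I_n => V i).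

(* The image of t (x) ... (x) t (n factors) under the regrouping isomorphism
   (V_1 (x) ... (x) V_k)^{(x) n} -> V_1^{(x) n} (x) ... (x) V_k^{(x) n}: write
   each factor in the product basis and expand. *)
Definition tens_pow (t : tens V) (n : nat) : tens (tens_pow_space n) :=
  \sum_(A : {ffun 'I_n -> tidx V})
    (\prod_m t (A m)) *:
      pure (fun i => pure (fun m : 'I_n => (vbasis {: V i})`_(A m i))
                     : tens_pow_space n i).

End Power.

Lemma bigA_distr_dffun (R : comPzRingType) (K : finType) (T : K -> finType)
    (f : forall i, T i -> R) :
  \sum_(a : {dffun forall i, T i}) \prod_i f i (a i) =
  \prod_i \sum_(x : T i) f i x.
Proof.
rewrite (reindex (@dffun_of_fprod _ T)); last exact/onW_bij/dffun_of_fprod_bij.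
transitivity (\sum_(t : fprod T) \prod_(i in K) [ffun x => f i x] (t i)).
  by apply: eq_bigr => t _; apply: eq_bigr => i _; rewrite !ffunE.
rewrite (@big_fprod R 0 1 *%R +%R K T (fun i => [ffun x => f i x])).
have -> : \prod_i \sum_(x : T i) f i x =
    \prod_i \sum_(u : {i : K & T i} | u \in tagged_with T i)
      untag 0 [ffun x => f i x] u.
  apply: eq_bigr => i _. rewrite -(big_tag (fun i (x : T i) => [ffun x => f i x] x) i).
  by apply: eq_bigr => x _; rewrite ffunE.
by rewrite bigA_distr_big_dep.
Qed.

Section SupportFunctional.
Variables (R : realType) (F : fieldType) (K : finType) (V : K -> vectType F).

Definition is_prob (T : finType) (p : T -> R) : Prop :=
  (forall x, 0 <= p x) /\ \sum_x p x = 1.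

(* no case split at p x = 0 is needed: 0 * ln 0 = 0 *)
Definition entropy (T : finType) (p : T -> R) : R :=
  - \sum_x p x * (ln (p x) / ln 2).

Definition marginal (P : tidx V -> R) (i : K) : 'I_(\dim {: V i}) -> R :=
  fun x => \sum_(a : tidx V | a i == x) P a.

Definition bases := forall i : K, (\dim {: V i}).-tuple (V i).

Definition are_bases (C : bases) : Prop := forall i, basis_of {: V i} (C i).

Definition tens_basis (C : bases) : #|{: tidx V}|.-tuple (tens V) :=
  [tuple pure (fun i => tnth (C i) ((enum_val p : tidx V) i))
    | p < #|{: tidx V}|].

Lemma tens_basisP (C : bases) :
  are_bases C -> basis_of {: tens V} (tens_basis C).
Proof.
move=> hC; rewrite basisEdim size_tuple dimvf /=.
apply/andP; split; last by rewrite /dim /= muln1.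
apply/subvP => t _.
have -> : t = 
    \sum_(a : tidx V) (\sum_(b : tidx V) t b *
      \prod_i coord (C i) (a i) (vbasis {: V i})`_(b i)) *:
        pure (fun i => tnth (C i) (a i)).
  apply/ffunP => c; rewrite sum_ffunE.
  under eq_bigr do rewrite !ffunE /GRing.scale /= mulr_suml.
  rewrite exchange_big /=.
  under eq_bigr => b _ do under eq_bigr => a _ do rewrite -mulrA -big_split /=.
  under eq_bigr => b _.
    rewrite -mulr_sumr (bigA_distr_dffun
      (fun i x => coord (C i) x (vbasis {: V i})`_(b i) *
        coord (vbasis {: V i}) (c i) (tnth (C i) x))).
    under eq_bigr => i _.
      have -> : \sum_x coord (C i) x (vbasis {: V i})`_(b i) *
        coord (vbasis {: V i}) (c i) (tnth (C i) x) = (b i == c i)%:R.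
        rewrite -(coord_free _ _ (basis_free (vbasisP {: V i}))).
        rewrite [in RHS](coord_basis (hC i) (memvf (vbasis {: V i})`_(b i))).
        rewrite linear_sum /=.
        by apply: eq_bigr => x _; rewrite linearZ /= (tnth_nth 0).
      over.
    over.
  rewrite (bigD1 c) //= big1 ?big1 ?mulr1 ?addr0 // => [b nbc|i _]; last by rewrite eqxx.
  have [i nb] : exists i, b i != c i.
    apply/existsP; apply: contraNT nbc => /existsPn h; apply/eqP/ffunP => i.
    by apply/eqP; have := h i; rewrite negbK.
  by rewrite (bigD1 i) //= (negbTE nb) mul0r mulr0.
apply: memv_suml => a _; apply: memvZ; apply: memv_span.
apply/(tnthP (tens_basis C)); exists (enum_rank a); rewrite tnth_mktuple enum_rankK //.
Qed.

Definition tens_coef (C : bases) (t : tens V) (a : tidx V) : F :=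
  coord (tens_basis C) (enum_rank a) t.

Definition tens_supp (C : bases) (t : tens V) : {set tidx V} :=
  [set a | tens_coef C t a != 0].

Definition prob_on (S : {set tidx V}) (P : tidx V -> R) : Prop :=
  is_prob P /\ forall a, a \notin S -> P a = 0.

(* Used for nonempty S only.  The supremum is a maximum (a continuous function
   on a simplex). *)
Definition max_entropy (theta : K -> R) (S : {set tidx V}) : R :=
  sup [set \sum_i theta i * entropy (@marginal P i) | P in prob_on S]%classic.

(* The infimum is a minimum: the tens_supp C t range over a finite type. *)
Definition rho (theta : K -> R) (t : tens V) : R :=
  inf [set max_entropy theta (tens_supp C t) | C in are_bases]%classic.

Definition zeta (theta : K -> R) (t : tens V) : R :=
  if t == 0 then 0 else 2 `^ rho theta t.

End SupportFunctional.

(* Main.v *)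
(** Fix bases C and let S be the support of t in them.  Expanding in the product
    bases, t^(x)n is a combination of the pure tensors indexed by the words A in
    S^n.  The empirical distribution P of A lives on S, so the theta-average of
    the entropies H(P_j) is at most the maximal entropy h of S, and some
    coordinate word A_j has H(P_j) <= h.  Collecting the terms that share such a
    j and the same word A_j gives one slice for each pair (j, A_j).  By the
    method of types there are at most (n+1)^(dim V_j) 2^(nh) words of empirical
    entropy at most h, and the polynomial factor disappears in the n-th root.
    The infimum over C is taken at the level of logarithms. *)

Require Import Defs.
From HB Require Import structures.
From mathcomp Require Import all_boot all_order all_algebra.
From mathcomp Require Import all_classical all_reals all_analysis.
From mathcomp Require Import ring lra.

Set Implicit Arguments.
Unset Strict Implicit.
Unset Printing Implicit Defensive.

Import Order.TTheory GRing.Theory Num.Theory.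

Local Open Scope ring_scope.

(** * Multilinear expansion of tensor powers and grouping into slices *)

Lemma pure_sum (F : fieldType) (K : finType) (V : K -> vectType F)
    (T : K -> finType) (c : forall i, T i -> F)
    (u : forall i, T i -> V i) :
  pure (fun i => \sum_(y : T i) c i y *: u i y) =
  \sum_(Y : {dffun forall i, T i})
    (\prod_i c i (Y i)) *: pure (fun i => u i (Y i)).
Proof.
apply/ffunP => a; rewrite sum_ffunE ffunE.
under eq_bigr do rewrite linear_sum /=.
rewrite -(bigA_distr_dffun (fun i y =>
  coord (vbasis {: V i}) (a i) (c i y *: u i y))).
apply: eq_bigr => Y _; rewrite !ffunE /GRing.scale /= -big_split /=.
by apply: eq_bigr => i _; rewrite linearZ.
Qed.

Section TensorPowers.
Variables (F : fieldType) (K : finType).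

Lemma pure_slice (V : K -> vectType F) (j : K) (v : forall i, V i) :
  pure v = slice (v j) (pure (fun i : {i : K | i != j} => v (val i))
                        : tens (@others F K V j)).
Proof.
apply/ffunP => a; rewrite !ffunE (bigD1 j) //=; congr (_ * _).
rewrite (big_sub (fun i => i != j)
  (fun i => coord (vbasis {: V i}) (a i) (v i))).
by apply: eq_bigr => i _; rewrite ffunE.
Qed.

Lemma slice_sumr (V : K -> vectType F) (j : K) (I : finType) (P : pred I)
    (v : V j) (c : I -> F) (w : I -> tens (@others F K V j)) :
  \sum_(l | P l) c l *: slice v (w l) = slice v (\sum_(l | P l) c l *: w l).
Proof.
apply/ffunP => a; rewrite sum_ffunE !ffunE sum_ffunE mulr_sumr.
by apply: eq_bigr => l _; rewrite !ffunE /GRing.scale /= mulrCA.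
Qed.

Variable V : K -> vectType F.

(** The regrouping isomorphism on indices: one word per leg becomes one word of index tuples. *)
Definition transpose_idx n (Y : {dffun forall i : K,
    {dffun forall m : 'I_n, 'I_(\dim {: V i})}}) : {ffun 'I_n -> tidx V} :=
  [ffun m => [ffun i => Y i m]].

Lemma transpose_idx_bij n : bijective (@transpose_idx n).
Proof.
exists (fun A : {ffun 'I_n -> tidx V} =>
  [ffun i => [ffun m => A m i]] : {dffun forall i : K,
    {dffun forall m : 'I_n, 'I_(\dim {: V i})}}).
  by move=> Y; apply/ffunP => i; apply/ffunP => m; rewrite !ffunE.
by move=> A; apply/ffunP => m; apply/ffunP => i; rewrite !ffunE.
Qed.

Definition pure_pow n (u : 'I_n -> forall i, V i) : tens (tens_pow_space V n) :=
  pure (fun i => pure (fun m : 'I_n => u m i) : tens_pow_space V n i).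

(** Multilinearity ([pure_sum]) is applied twice, first inside each leg and then across the legs. *)
Lemma pure_pow_expand n (u : 'I_n -> forall i, V i) :
  pure_pow u = \sum_(B : {ffun 'I_n -> tidx V})
    (\prod_m (pure (u m) : tens V) (B m)) *:
      pure_pow (fun m i => (vbasis {: V i})`_(B m i)).
Proof.
rewrite /pure_pow.
have -> : (fun i => pure (fun m : 'I_n => u m i) : tens_pow_space V n i) =
  (fun i => \sum_(y : {dffun forall m : 'I_n, 'I_(\dim {: V i})})
     (\prod_m coord (vbasis {: V i}) (y m) (u m i)) *:
     (pure (fun m : 'I_n => (vbasis {: V i})`_(y m)) : tens_pow_space V n i)).
  apply: functional_extensionality_dep => i.
  rewrite -(pure_sum (fun (m : 'I_n) y => coord (vbasis {: V i}) y (u m i))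
    (fun (m : 'I_n) (y : 'I_(\dim {: V i})) => (vbasis {: V i})`_y)).
  congr pure; apply: functional_extensionality_dep => m.
  exact: coord_vbasis (memvf _).
rewrite (pure_sum (fun i (y : {dffun forall m : 'I_n, 'I_(\dim {: V i})}) =>
     \prod_m coord (vbasis {: V i}) (y m) (u m i))
   (fun i y =>
     pure (fun m : 'I_n => (vbasis {: V i})`_(y m)) : tens_pow_space V n i)).
rewrite [RHS](reindex (@transpose_idx n)) /=;
  last exact/onW_bij/transpose_idx_bij.
apply: eq_bigr => Y _; congr (_ *: _).
  rewrite exchange_big; apply: eq_bigr => m _; rewrite ffunE.
  by apply: eq_bigr => i _; rewrite !ffunE.
congr pure; apply: functional_extensionality_dep => i; congr pure.
by apply: functional_extensionality_dep => m; rewrite !ffunE.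
Qed.

Lemma tens_basis_expand (C : bases V) (t : tens V) : are_bases C ->
  t = \sum_(a : tidx V) tens_coef C t a *: pure (fun i => tnth (C i) (a i)).
Proof.
move=> hC; rewrite [LHS](coord_basis (tens_basisP hC) (memvf t)).
rewrite (reindex enum_rank); last exact/onW_bij/enum_rank_bij.
apply: eq_bigr => a _; congr (_ *: _).
by rewrite -tnth_nth tnth_mktuple enum_rankK.
Qed.

(** Frees [tens_pow] from the bases [vbasis] of its definition: once every [pure_pow] is re-expanded
    in them, distributivity turns the coefficient at [B] into a product of coordinates of [t]. *)
Lemma tens_pow_basis_expand (C : bases V) (t : tens V) n : are_bases C ->
  tens_pow t n = \sum_(A : {ffun 'I_n -> tidx V})
    (\prod_m tens_coef C t (A m)) *:
      pure_pow (fun m i => tnth (C i) (A m i)).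
Proof.
move=> hC; under [RHS]eq_bigr => A _ do
  rewrite pure_pow_expand scaler_sumr.
rewrite exchange_big /=; apply: eq_bigr => B _.
under [RHS]eq_bigr do rewrite scalerA.
rewrite -scaler_suml; congr (_ *: _).
under [RHS]eq_bigr do rewrite -big_split /=.
rewrite -(bigA_distr_bigA (fun m a => tens_coef C t a *
  (pure (fun i => tnth (C i) (a i)) : tens V) (B m))).
apply: eq_bigr => m _; rewrite [in LHS](tens_basis_expand t hC) sum_ffunE.
by apply: eq_bigr => a _; rewrite !ffunE.
Qed.

(** [good] stands for low empirical entropy. Assigning each word over the support to a single good
    leg makes the groups disjoint, so no term is counted twice. *)
Lemma slice_rank_tens_pow_le (C : bases V) (t : tens V) n (j0 : K)
    (good : forall j : K, pred {ffun 'I_n -> 'I_(\dim {: V j})}) :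
    are_bases C ->
    (forall A : {ffun 'I_n -> tidx V}, (forall m, A m \in tens_supp C t) ->
      exists j, good j [ffun m => A m j]) ->
  (slice_rank (tens_pow t n) <= \sum_j #|good j|)%N.
Proof.
move=> hC hgood.
pose J : finType := {j : K & {ffun 'I_n -> 'I_(\dim {: V j})}}.
pose G : pred J := fun p => good (tag p) (tagged p).
pose row (A : {ffun 'I_n -> tidx V}) j : {ffun 'I_n -> 'I_(\dim {: V j})} :=
  [ffun m => A m j].
(* The default [j0] is reached only by words that leave the support. *)
pose pos A := odflt j0 [pick j | good j (row A j)].
pose f A : J := Tagged _ (row A (pos A)).
pose inS (A : {ffun 'I_n -> tidx V}) := [forall m, A m \in tens_supp C t].
have -> : (\sum_j #|good j| = #|G|)%N.
  under eq_bigr do rewrite -sum1_card.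
  rewrite -sum1_card.
  exact: (sig_big_dep xpredT (fun j (x : {ffun 'I_n -> 'I_(\dim {: V j})}) =>
    x \in good j) (fun _ _ => 1%N)).
apply: (slice_rankP _ j0).2.
pose term (A : {ffun 'I_n -> tidx V}) := (\prod_m tens_coef C t (A m)) *:
      pure_pow (fun m i => tnth (C i) (A m i)).
have fG A : inS A -> G (f A).
  move=> /forallP/hgood[j hj]; rewrite /G /f /= /pos.
  by case: pickP => [j' //|/(_ j)]; rewrite hj.
exists (fun l : 'I_#|G| => \sum_(A | inS A && (f A == enum_val l)) term A).
split.
  move=> l; case: (enum_val l) => j x.
  exists j, (pure (fun m => tnth (C j) (x m))).
  exists (\sum_(A | inS A && (f A == existT _ j x :> J))
    (\prod_m tens_coef C t (A m)) *: pure (fun i : {i : K | i != j} =>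
      pure (fun m : 'I_n => tnth (C (val i)) (A m (val i)))
        : others (tens_pow_space V n) i)).
  rewrite -slice_sumr; apply: eq_bigr => A /andP[_ /eqP fA].
  rewrite /term; congr (_ *: _).
  rewrite [LHS](pure_slice j); congr slice; congr pure.
  (* Equality of the legs comes first, since the two words are comparable only over the same leg. *)
  have : row A j = x.
    have ej : pos A = j by have /(congr1 (@tag _ _)) := fA.
    move: fA; rewrite /f ej => /eqP.
    by rewrite -tag_eqE /tag_eq /= eqxx tagged_asE => /eqP.
  by move=> <-; apply: functional_extensionality_dep => m; rewrite ffunE.
(* Words leaving the support have a zero coefficient; the others are partitioned by [f], with values
   in [G]. *)
rewrite (tens_pow_basis_expand t n hC) (bigID inS) /= [X in _ + X]big1 ?addr0.
  by rewrite (partition_big f G) //= (big_enum_val (A := G)).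
move=> A /forallPn[m]; rewrite inE negbK => /eqP cm.
by rewrite (bigD1 m) //= cm mul0r scale0r.
Qed.

End TensorPowers.

(** * The method of types *)

Section Types.
Variables (R : realType) (T : finType) (n : nat).
Implicit Type x : {ffun 'I_n -> T}.

(** The type of a word. Counts are at most [n], so [inord] never truncates, and the finite codomain
    bounds the number of types by [(n+1)^#|T|]. *)
Definition type_count x : {ffun T -> 'I_n.+1} :=
  [ffun y => inord #|[set m | x m == y]|].

Definition empirical x (y : T) : R := (type_count x y)%:R / n%:R.

Lemma type_countE x y : type_count x y = #|[set m | x m == y]| :> nat.
Proof.
by rewrite ffunE inordK // ltnS -[leqRHS]card_ord max_card.
Qed.

Lemma sum_type_count (G : T -> R) x :
  \sum_y (type_count x y)%:R * G y = \sum_m G (x m).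
Proof.
rewrite (partition_big x xpredT) //=; apply: eq_bigr => y _.
rewrite type_countE -sum1_card natr_sum mulr_suml.
by apply: eq_big => m; rewrite inE // => /eqP <-; rewrite mul1r.
Qed.

Lemma empirical_ge0 x y : 0 <= empirical x y.
Proof. by rewrite divr_ge0. Qed.

Lemma empirical_is_prob x : (0 < n)%N -> is_prob (empirical x).
Proof.
move=> n0; split=> [y|]; first exact: empirical_ge0.
rewrite -mulr_suml; have := sum_type_count (fun=> 1) x.
under eq_bigr do rewrite mulr1.
move=> ->; rewrite sumr_const card_ord divff //.
by rewrite pnatr_eq0 -lt0n.
Qed.

(* Under the product measure of the empirical distribution of [x0], every word
   with the same letter counts has probability [2^(- n H)]. *)
Lemma card_type_class_le x0 : (0 < n)%N ->
  #|[pred x | type_count x == type_count x0]|%:R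
    <= 2 `^ (n%:R * entropy (empirical x0)) :> R.
Proof.
move=> n0; set H := entropy _.
have nR : n%:R != 0 :> R by rewrite pnatr_eq0 -lt0n.
have ln2 : ln (2 : R) != 0 by rewrite gt_eqF // ln_gt0 // ltr1n.
have prodE x : type_count x = type_count x0 ->
    \prod_m empirical x0 (x m) = expR (- (n%:R * H * ln 2)).
  move=> ex.
  have -> : \prod_m empirical x0 (x m) =
      \prod_m expR (ln (empirical x0 (x m))).
    apply: eq_bigr => m _; rewrite lnK // posrE divr_gt0 ?ltr0n //.
    by rewrite -ex type_countE card_gt0; apply/set0Pn; exists m; rewrite inE.
  rewrite -expR_sum -(sum_type_count (fun y => ln (empirical x0 y))).
  congr expR; rewrite /H /entropy mulrN mulNr opprK mulr_sumr mulr_suml.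
  apply: eq_bigr => y _; rewrite ex {2}/empirical.
  by move: (ln (empirical _ _)) => l; field; apply/andP.
have tot : \sum_(x : {ffun 'I_n -> T}) \prod_m empirical x0 (x m) = 1.
  rewrite -(bigA_distr_bigA (fun (m : 'I_n) y => empirical x0 y)).
  by rewrite big1 // => m _; exact: (empirical_is_prob _ n0).2.
(* [2^(nH)] is the inverse of the common probability, so the claim says that the words of this type
   have total probability at most 1. *)
rewrite /powR pnatr_eq0 /= -[leRHS]invrK -expRN -[leRHS]mul1r.
rewrite ler_pdivlMr ?expR_gt0 // -[leRHS]tot -sum1_card natr_sum mulr_suml.
rewrite [leRHS](bigID [pred x | type_count x == type_count x0]) /=.
rewrite -[leLHS]addr0 lerD //; last first.
  by apply: sumr_ge0 => x _; apply: prodr_ge0 => m _; exact: empirical_ge0.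
by apply: ler_sum => x /eqP ex; rewrite mul1r prodE.
Qed.

(** There are at most [(n+1)^#|T|] types, and a type containing a word of entropy at most [h] has at
    most [2^(nh)] words. *)
Lemma card_low_entropy_le (h : R) : (0 < n)%N ->
  #|[pred x | entropy (empirical x) <= h]|%:R
    <= n.+1%:R ^+ #|T| * 2 `^ (n%:R * h) :> R.
Proof.
move=> n0; rewrite -sum1_card natr_sum.
rewrite (partition_big type_count xpredT) //=.
apply: (@le_trans _ _ (\sum_(c : {ffun T -> 'I_n.+1}) 2 `^ (n%:R * h))).
  apply: ler_sum => c _; rewrite -natr_sum sum1_card.
  have [x0 /andP[hx0 /eqP cx0]|no] :=
      pickP [pred x | (entropy (empirical x) <= h) && (type_count x == c)].
    apply: le_trans (le_trans (card_type_class_le x0 n0) _).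
      rewrite ler_nat subset_leq_card //; apply/fintype.subsetP => x.
      by rewrite !inE cx0 => /andP[].
    by apply: ler_powR; rewrite ?ler1n // ler_wpM2l.
  rewrite eq_card0 ?powR_ge0 // => x; exact: no.
by rewrite sumr_const card_ffun card_ord -natrX [leRHS]mulr_natl.
Qed.

End Types.

(** * Entropies of marginals and of empirical distributions *)

Section MaxEntropy.
Variables (R : realType).

(** For [p > 0] each [- p ln p] is at most 1, since [ln (1/p) < 1/p]. This crude bound serves to
    make the supremum in [max_entropy] finite. *)
Lemma entropy_le_card (T : finType) (p : T -> R) : (forall y, 0 <= p y) ->
  entropy p <= #|T|%:R / ln 2.
Proof.
move=> p0; rewrite /entropy.
under eq_bigr do rewrite mulrA.
rewrite -mulr_suml -mulNr ler_wpM2r ?invr_ge0 ?ln_ge0 ?ler1n //.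
rewrite -sumrN -sum1_card natr_sum; apply: ler_sum => y _.
have [->|py] := eqVneq (p y) 0; first by rewrite mul0r oppr0.
have py0 : 0 < p y by rewrite lt_neqAle eq_sym py p0.
rewrite -mulrN -lnV ?posrE // mulrC -ler_pdivlMr // mul1r.
by apply/ltW/ln_sublinear; rewrite invr_gt0.
Qed.

Variables (F : fieldType) (K : finType) (V : K -> vectType F).

Lemma le_max_entropy (theta : K -> R) (S : {set tidx V}) (P : tidx V -> R) :
  is_prob theta -> prob_on S P ->
  \sum_i theta i * entropy (@marginal R F K V P i) <= max_entropy theta S.
Proof.
move=> [th0 _] hP; apply: ub_le_sup; last by exists P.
exists (\sum_i theta i * (#|'I_(\dim {: V i})|%:R / ln 2)).
move=> _ [Q [[Q0 _] _] <-]; apply: ler_sum => i _.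
by rewrite ler_wpM2l // entropy_le_card // => y; apply: sumr_ge0.
Qed.

(** At a letter [y] both sides are the proportion of positions [m] with [A m i = y]. *)
Lemma marginal_empirical n (A : {ffun 'I_n -> tidx V}) i :
  @marginal R F K V (empirical R A) i =
  empirical R [ffun m => A m i].
Proof.
apply/funext => y; rewrite /marginal -mulr_suml; congr (_ / _).
rewrite big_mkcond /=.
transitivity (\sum_a (type_count A a)%:R * (a i == y)%:R : R).
  by apply: eq_bigr => a _; case: (a i == y); rewrite ?mulr1 ?mulr0.
rewrite (sum_type_count (fun a : tidx V => (a i == y)%:R)) type_countE.
rewrite -sum1_card natr_sum [RHS]big_mkcond /=.
by apply: eq_bigr => m _; rewrite inE ffunE; case: (_ == _).
Qed.

Lemma exists_low_entropy_marginal (theta : K -> R) (S : {set tidx V}) n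
    (A : {ffun 'I_n -> tidx V}) : is_prob theta -> (0 < n)%N ->
  (forall m, A m \in S) ->
  exists j, entropy (empirical R [ffun m => A m j]) <= max_entropy theta S.
Proof.
move=> hth n0 AS; apply/existsP; apply: contraT => /existsPn hlt.
have hP : prob_on S (empirical R A).
  split; first exact: empirical_is_prob.
  move=> a aS; rewrite /empirical type_countE eq_card0 ?mul0r // => m.
  by rewrite !inE; apply: contraNF aS => /eqP <-.
have := le_max_entropy hth hP; rewrite leNgt => /negP[].
(* The weights sum to 1, so one is positive; it makes the averaged inequality strict. *)
have [j _ thj] : exists2 j : K, true & 0 < theta j.
  apply/exists_inP; apply: contraT => /exists_inPn h0.
  suff /eqP : \sum_j theta j = 0 by rewrite hth.2 oner_eq0.
  rewrite big1 // => j _; apply: le_anti; rewrite hth.1 andbT leNgt.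
  exact: h0.
rewrite -[ltLHS]mul1r -hth.2 mulr_suml.
rewrite (bigD1 j) //= [ltRHS](bigD1 j) //= ltr_leD //.
  by rewrite marginal_empirical ltr_pM2l // ltNge.
apply: ler_sum => i _; rewrite marginal_empirical ler_wpM2l ?hth.1 //.
by rewrite ltW // ltNge.
Qed.

End MaxEntropy.

(** * Asymptotic estimates *)

Section Asymptotics.
Variable R : realType.

Lemma polynomial_le_powR2 (D N : nat) (d : R) : (0 < D)%N -> 0 < d ->
  \forall n \near \oo%classic, D%:R * n.+1%:R ^+ N <= 2 `^ (n%:R * d) :> R.
Proof.
move=> D0 d0.
have ln2 : 0 < ln (2 : R) by rewrite ln_gt0 // ltr1n.
pose e := d * ln 2; have e0 : 0 < e by rewrite mulr_gt0.
(* [ln x <= c x - ln c] bounds [N ln (n+1)] by a linear function of [n]; this [c] keeps its slope at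
   most [e / 2]. [N.+1] avoids a division by 0 when [N = 0]. *)
pose c := e / (2 * N.+1%:R).
have N0 : 0 < N.+1%:R :> R by rewrite ltr0n.
have c0 : 0 < c by rewrite divr_gt0 // mulr_gt0.
have Nc : N%:R * c <= e / 2.
  have -> : e / 2 = N.+1%:R * c by rewrite /c; field; rewrite gt_eqF.
  by rewrite ler_pM2r // ler_nat.
(* The constant terms of the bound, the summand [c] coming from [n+1]; the other half of [e] absorbs
   them for large [n]. *)
pose B := ln D%:R + N%:R * (c - ln c).
near=> n.
have nB : 2 * B / e <= n%:R by near: n; exact: nbhs_infty_ger.
have n0 : 0 < n.+1%:R :> R by rewrite ltr0n.
have DR : 0 < D%:R :> R by rewrite ltr0n.
rewrite /powR pnatr_eq0 /= -[leLHS]lnK ?posrE ?mulr_gt0 ?exprn_gt0 //.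
rewrite ler_expR lnM ?posrE ?exprn_gt0 // lnXn // -[_ *+ N]mulr_natl -mulrA -/e.
have lnn : ln n.+1%:R <= c * n.+1%:R - ln c.
  by rewrite lerBrDr -lnM ?posrE // mulrC ltW // ln_sublinear // mulr_gt0.
have h1 := ler_wpM2l (ler0n R N) lnn.
have h2 : B <= n%:R * e / 2 by move: nB; rewrite ler_pdivrMr // => ?; lra.
have h3 := ler_wpM2l (ler0n R n) Nc.
rewrite -natr1 in h1 *.
rewrite /B in h2.
lra.
Unshelve. all: by end_near.
Qed.

(** The limsup is an infimum over the sets of the filter, and the set where [u n <= M] is one of
    them. *)
Lemma limn_esup_le_near (u : nat -> \bar R) (M : \bar R) :
  (\forall n \near \oo%classic, (u n <= M)%E) -> (limn_esup u <= M)%E.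
Proof.
move=> uM; apply: (@le_trans _ _
  (ereal_sup [set u n | n in [set n | (u n <= M)%E]]%classic)).
  by apply: ereal_inf_lbound; exists [set n | (u n <= M)%E]%classic.
by apply: ge_ereal_sup => _ [n un <-].
Qed.

End Asymptotics.

(** * From words of low entropy to the support functional *)

Section SupportBound.
Variables (R : realType) (F : fieldType) (K : finType) (V : K -> vectType F).

(** With [n > 0] every coefficient contains a factor 0; for [n = 0] it is an empty product. *)
Lemma slice_rank_tens_pow0 n : (0 < n)%N -> K ->
  slice_rank (tens_pow (0 : tens V) n) = 0%N.
Proof.
move=> n0 j0; apply/eqP; rewrite -leqn0; apply: (slice_rankP _ j0).2.
exists (fun=> 0); split; first by case.
rewrite big_ord0 /tens_pow big1 // => A _.
by rewrite (bigD1 (Ordinal n0)) //= ffunE mul0r scale0r.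
Qed.

Lemma slice_rank_tens_pow_low_entropy (theta : K -> R) (C : bases V)
    (t : tens V) n : is_prob theta -> are_bases C -> (0 < n)%N -> K ->
  (slice_rank (tens_pow t n))%:R <=
    #|K|%:R * n.+1%:R ^+ (\sum_j \dim {: V j}) *
      2 `^ (n%:R * max_entropy theta (tens_supp C t)) :> R.
Proof.
move=> hth hC n0 j0; set h := max_entropy _ _.
have := @slice_rank_tens_pow_le F K V C t n j0
  (fun j => [pred x | entropy (empirical R x) <= h]) hC.
move=> /(_ (fun A AS => exists_low_entropy_marginal hth n0 AS)).
rewrite -(ler_nat R) => /le_trans; apply; rewrite natr_sum.
(* Each exponent [\dim {: V j}] is raised to the sum over all legs, so that the summands share one
   bound and yield the factor [#|K|]. *)
rewrite -mulrA [leRHS]mulr_natl -sumr_const; apply: ler_sum => j _.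
apply: le_trans (@card_low_entropy_le R 'I_(\dim {: V j}) n h n0) _.
rewrite card_ord ler_wpM2r ?powR_ge0 // ler_weXn2l ?ler1n //.
by rewrite (bigD1 j) //= leq_addr.
Qed.

(** The slack [d] pays for the polynomial factor, which is at most [2^(nd)] for large [n]. *)
Lemma limn_esup_slice_rank_le (theta : K -> R) (C : bases V) (t : tens V)
    (d : R) : is_prob theta -> are_bases C -> K -> 0 < d ->
  (limn_esup (fun n : nat =>
      ((slice_rank (tens_pow t n))%:R `^ (n%:R^-1) : R)%:E)
   <= (2 `^ (d + max_entropy theta (tens_supp C t)))%:E)%E.
Proof.
move=> hth hC j0 d0; apply: limn_esup_le_near.
have K0 : (0 < #|K|)%N by apply/card_gt0P; exists j0.
near=> n.
have n0 : (0 < n)%N by near: n; exact: nbhs_infty_gt.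
have nR : n%:R != 0 :> R by rewrite pnatr_eq0 -lt0n.
have hn : #|K|%:R * n.+1%:R ^+ (\sum_j \dim {: V j}) <= 2 `^ (n%:R * d) :> R.
  by near: n; exact: polynomial_le_powR2.
set h := max_entropy _ _.
have -> : d + h = n%:R * (d + h) * n%:R^-1 by field.
rewrite lee_fin powRrM ge0_ler_powR ?invr_ge0 ?nnegrE ?powR_ge0 //.
apply: le_trans (slice_rank_tens_pow_low_entropy t hth hC n0 j0) _.
rewrite mulrDr powRD; last by rewrite pnatr_eq0 implybT.
by rewrite ler_wpM2r ?powR_ge0.
Unshelve. all: by end_near.
Qed.

End SupportBound.

Theorem theorem5p8 (R : realType) (F : fieldType) (k : nat) (hk : (3 <= k)%N)
    (V : 'I_k -> vectType F) (t : tens V) (theta : 'I_k -> R)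
    (htheta : is_prob theta) :
  (limn_esup (fun n : nat =>
      ((slice_rank (tens_pow t n))%:R `^ (n%:R^-1) : R)%:E)
   <= (zeta theta t)%:E)%E.
Proof.
have j0 : 'I_k by apply: (@Ordinal k 0); exact: ltn_trans hk.
rewrite /zeta; case: eqVneq => [->|_].
  (* [n > 0] also keeps the exponent [n^-1] nonzero, as 0 to the power 0 is 1. *)
  apply: limn_esup_le_near; near=> n.
  have n0 : (0 < n)%N by near: n; exact: nbhs_infty_gt.
  by rewrite slice_rank_tens_pow0 // powR0 // invr_eq0 pnatr_eq0 -lt0n.
have := fun C d hC => @limn_esup_slice_rank_le R F _ V theta C t d htheta hC j0.
have : (0 <= limn_esup (fun n : nat =>
    ((slice_rank (tens_pow t n))%:R `^ (n%:R^-1) : R)%:E))%E.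
  by apply: limf_esup_ge0 => [[N _ /(_ N)]/(_ (leqnn _))//|n];
     rewrite lee_fin powR_ge0.
have vbP : are_bases (fun i => vbasis {: V i}) by move=> i; exact: vbasisP.
(* Nonnegativity excludes [-oo], and the bound for the bases [vbasis] with [d = 1] excludes
   [+oo]. *)
case: (limn_esup _) => [L|_ /(_ _ 1 vbP ltr01)//|//].
(* A zero limsup is treated apart, since the passage to [ln L] requires [L > 0]. *)
rewrite lee_fin le_eqVlt => /predU1P[<- _|L0 hL].
  by rewrite lee_fin powR_ge0.
have ln2 : 0 < ln (2 : R) by rewrite ln_gt0 // ltr1n.
rewrite lee_fin /powR pnatr_eq0 /= -[leLHS]lnK ?posrE // ler_expR.
rewrite -ler_pdivrMr //; apply: lb_le_inf.
  by eexists; exists (fun i => vbasis {: V i}).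
(* The slack [d] is removed for each [C] separately, which makes [ln L / ln 2] a lower bound of the
   set whose infimum is [rho]. *)
move=> _ [C hC <-]; apply/ler_addgt0Pl => d d0.
have := hL C d hC d0; rewrite lee_fin /powR pnatr_eq0 /=.
by rewrite -[leLHS]lnK ?posrE // ler_expR ler_pdivrMr.
Unshelve. all: by end_near.
Qed.
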